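(* Let $G=(V_1,E_1)$ be a connected graph with $|V_1|\ge2$ and $H=(V_2,E_2)$ a $\kappa$-regular graph on $n=|V_2|$ vertices, where $n\ge1$ and $\kappa\ge0$. Let $A_H$ be the adjacency matrix of $H$ and assume that $\min\mathrm{ev}(A_H)=-2$. Then \[ \mathrm{QEC}(G\odot H)=\begin{cases}\psi_{H*}^{-1}(\mathrm{QEC}(G)), & \text{if } \mathrm{QEC}(G)>0,\\ 0,&\text{otherwise,}\end{cases} \] where \[ \psi_{H*}^{-1}(\mathrm{QEC}(G))=\frac12\Bigl\{(n+1)\mathrm{QEC}(G)-(\kappa+2)+\sqrt{((n+1)\mathrm{QEC}(G)-(\kappa+2))^2+4(\kappa+2)\mathrm{QEC}(G)}\,\Bigr\}. \]
   Context: All graphs are finite, simple and undirected. For a connected graph $G=(V,E)$ with $|V|\ge2$ and distance matrix $D=[d(x,y)]_{x,y\in V}$ (graph distance), $\mathrm{QEC}(G)=\max\{\langle f,Df\rangle\,;\, f\in C(V),\ \langle f,f\rangle=1,\ \langle \mathbf{1},f\rangle=0\}$, where $C(V)$ is the space of real column vectors indexed by $V$ with the canonical inner product and $\mathbf{1}$ is the all-one vector. Corona: for graphs $G=(V_1,E_1)$, $H=(V_2,E_2)$ with $V_1\cap V_2=\emptyset$, $G\odot H$ is obtained from $G$ and $|V_1|$ disjoint copies of $H$ (one for each vertex of $G$) by joining each vertex of $G$ to every vertex of its copy of $H$. $\mathrm{ev}(A_H)$ denotes the set of distinct eigenvalues of $A_H$. The notation $\psi_{H*}^{-1}$ refers to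 the inverse of the restriction to $(-\frac{\kappa+2}{n+1},+\infty)$ of $\psi_H(\lambda)=\frac{\lambda(\lambda+\kappa+2)}{(n+1)\lambda+\kappa+2}$; its value at $\mathrm{QEC}(G)$ is given explicitly by the formula in the claim. *)

(* Defs.v *)
From mathcomp Require Import all_boot all_order all_algebra.
From mathcomp Require Import all_classical all_reals all_analysis.

Set Implicit Arguments.
Unset Strict Implicit.
Unset Printing Implicit Defensive.

Import Order.TTheory GRing.Theory Num.Theory.
Import numFieldNormedType.Exports.

Local Open Scope classical_set_scope.
Local Open Scope ring_scope.

Record sgraph (V : finType) := SGraph {
  adj :> rel V;
  adj_sym : symmetric adj;
  adj_irr : irreflexive adj }.

Definition connected_graph (V : finType) (G : sgraph V) : Prop :=
  forall x y : V, connect G x y.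

Definition regular_graph (V : finType) (G : sgraph V) (k : nat) : Prop :=
  forall x : V, #|[set y | G x y]%SET| = k.

Definition has_walk (V : finType) (G : sgraph V) (x y : V) (m : nat) : bool :=
  [exists p : m.-tuple V, path G x p && (last x p == y)].

(* Between connected vertices the least length of a walk is smaller than #|V|;
   for disconnected ones this returns the junk value #|V|. See gdistP. *)
Definition gdist (V : finType) (G : sgraph V) (x y : V) : nat :=
  find (has_walk G x y) (iota 0 #|V|).

Lemma gdistP (V : finType) (G : sgraph V) (x y : V) : connect G x y ->
  has_walk G x y (gdist G x y) /\
  forall m, has_walk G x y m -> (gdist G x y <= m)%N.
Proof.
move=> /connectP[p0 p0P yE].
have hs : has (has_walk G x y) (iota 0 #|V|).
  case: (shortenP p0P) (yE) => p pP pU _ yE'.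
  apply/hasP; exists (size p).
    rewrite mem_iota /= add0n.
    by have := max_card (mem (x :: p)); rewrite (card_uniqP pU).
  by apply/existsP; exists (in_tuple p); rewrite pP /= yE'.
have hlt : (gdist G x y < #|V|)%N.
  by rewrite -[X in (_ < X)%N](size_iota 0) -has_find.
split; first by have := nth_find 0%N hs; rewrite nth_iota.
move=> m hm; rewrite leqNgt; apply/negP => lt_m.
have := before_find 0%N lt_m.
by rewrite nth_iota ?hm // (ltn_trans lt_m hlt).
Qed.

Section Matrices.
Variables (R : realType) (V : finType) (G : sgraph V).

(* Column vectors and matrices over V are indexed by 'I_#|V|, through the
   enumeration enum_val of V. *)
Definition adj_mx : 'M[R]_#|V| :=
  \matrix_(i, j) (G (enum_val i) (enum_val j))%:R.

Definition dist_mx : 'M[R]_#|V| :=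
  \matrix_(i, j) (gdist G (enum_val i) (enum_val j))%:R.

Definition ev (n : nat) (A : 'M[R]_n) : set R := [set a | eigenvalue A a].

Definition inner (n : nat) (u v : 'cV[R]_n) : R := \sum_i u i 0 * v i 0.

Definition QEC_dom : set 'cV[R]_#|V| :=
  [set f | inner f f = 1 /\ inner (const_mx 1) f = 0].

Definition QEC_values : set R :=
  [set inner f (dist_mx *m f) | f in QEC_dom].

(* A maximum when 2 <= #|V|, see QEC_max. *)
Definition QEC : R := sup QEC_values.

End Matrices.

Arguments adj_mx R {V} G.
Arguments dist_mx R {V} G.
Arguments QEC_values R {V} G.
Arguments QEC R {V} G.

Lemma continuous_sumr (R : realType) (T : topologicalType) (I : Type)
    (s : seq I) (h : I -> T -> R) :
  (forall i, continuous (h i)) -> continuous (fun v => \sum_(i <- s) h i v).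
Proof.
move=> ch v; elim: s => [|i s IH].
  rewrite (_ : (fun v => _) = (fun=> 0)); first exact: cvg_cst.
  by apply/funext => w; rewrite big_nil.
rewrite (_ : (fun v => _) = (h i \+ (fun v => \sum_(j <- s) h j v))).
  by apply: continuousD => //; exact: ch.
by apply/funext => w; rewrite big_cons.
Qed.

Lemma continuous_inner (R : realType) (T : topologicalType) (n : nat)
    (f g : T -> 'cV[R]_n) :
  (forall i, continuous (fun v => f v i 0)) ->
  (forall i, continuous (fun v => g v i 0)) ->
  continuous (fun v => inner (f v) (g v)).
Proof.
move=> cf cg; apply: continuous_sumr => i v.
by apply: cvgM; [exact: cf|exact: cg].
Qed.

Lemma QEC_dom_neq0 (R : realType) (V : finType) : (1 < #|V|)%N ->
  exists f : 'cV[R]_#|V|, QEC_dom f.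
Proof.
move=> V1; pose i0 := Ordinal (ltnW V1); pose i1 := Ordinal V1.
have n01 : i1 != i0 by [].
pose c : R := (Num.sqrt 2)^-1.
pose f : 'cV[R]_#|V| :=
  \col_i (if i == i0 then c else if i == i1 then - c else 0).
have c2 : c * c = 2^-1 by rewrite -invfM -expr2 sqr_sqrtr.
have fE g : \sum_i g i * f i 0 = g i0 * c - g i1 * c.
  rewrite (bigD1 i0) //= (bigD1 i1) //= big1 ?addr0 => [|i /andP[h0 h1]].
    by rewrite !mxE eqxx (negbTE n01) eqxx mulrN.
  by rewrite !mxE (negbTE h0) (negbTE h1) mulr0.
exists f; split; rewrite /inner fE.
  rewrite !mxE eqxx (negbTE n01) eqxx mulNr opprK c2.
  by rewrite -[2^-1]mul1r -splitr.
by rewrite !mxE subrr.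
Qed.

Lemma QEC_max (R : realType) (V : finType) (G : sgraph V) : (1 < #|V|)%N ->
  QEC_values R G (QEC R G) /\ ubound (QEC_values R G) (QEC R G).
Proof.
move=> V1.
pose A : set 'rV[R]_#|V| := [set v | QEC_dom v^T].
have ctr i : continuous (fun v : 'rV[R]_#|V| => v^T i 0).
  rewrite (_ : (fun v => _) = (fun v : 'rV[R]_#|V| => v 0 i)).
    exact: coord_continuous.
  by apply/funext => v; rewrite mxE.
have cA : compact A.
  have Kco : compact [set v : 'rV[R]_#|V| |
      forall i, `[(-1 : R), 1]%classic (v ord0 i)].
    by apply: (@rV_compact _ _ (fun=> `[(-1 : R), 1]%classic)) => _; exact: segment_compact.
  apply: (subclosed_compact _ Kco).
    apply: closedI.
      apply: (@preimage_closed _ _ (fun v : 'rV[R]_#|V| => inner v^T v^T) [set 1]).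
        by move=> v _; exact: continuous_inner.
      exact: closed_eq.
    apply: (@preimage_closed _ _
      (fun v : 'rV[R]_#|V| => inner (const_mx 1) v^T) [set 0]).
      by move=> v _; apply: continuous_inner => // i; exact: cst_continuous.
    exact: closed_eq.
  move=> v [v1 _] i /=; rewrite in_itv /= -ler_norml -(@ler_sqr R) ?nnegrE //.
  rewrite expr1n -normrX ger0_norm ?sqr_ge0 // -v1 /inner (bigD1 i) //= !mxE.
  by rewrite expr2 lerDl sumr_ge0 // => j _; rewrite -expr2 sqr_ge0.
have A0 : A !=set0.
  by have [f fP] := QEC_dom_neq0 R V1; exists f^T; rewrite /A /= trmxK.
pose F (v : 'rV[R]_#|V|) := inner v^T (dist_mx R G *m v^T).
have cF : continuous F.
  apply: continuous_inner => // i.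
  rewrite (_ : (fun v => _) =
    (fun v : 'rV[R]_#|V| => \sum_j dist_mx R G i j * v^T j 0)).
    apply: continuous_sumr => j v.
    by apply: continuousM; [exact: cst_continuous | exact: ctr].
  by apply/funext => v; rewrite mxE.
have [v vA vmax] := EVT_max_rV A0 cA (continuous_subspaceT cF).
have ubv : ubound (QEC_values R G) (F v).
  move=> _ [f fP <-]; have := vmax f^T; rewrite /F trmxK; apply.
  by rewrite inE /A /= trmxK.
have Vv : QEC_values R G (F v) by exists v^T => //; move: vA; rewrite inE.
suff -> : QEC R G = F v by [].
apply/le_anti/andP; split; first by apply: ge_sup => //; exists (F v).
by apply: ub_le_sup => //; exists (F v).
Qed.

Definition corona_rel (V1 V2 : finType) (G : sgraph V1) (H : sgraph V2) :
    rel (V1 + V1 * V2)%type := fun u v =>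
  match u, v with
  | inl x, inl y => G x y
  | inl x, inr (y, _) | inr (y, _), inl x => x == y
  | inr (x, a), inr (y, b) => (x == y) && H a b
  end.

Lemma corona_sym (V1 V2 : finType) (G : sgraph V1) (H : sgraph V2) :
  symmetric (corona_rel G H).
Proof.
move=> [x|[x a]] [y|[y b]] //=; first exact: adj_sym.
by rewrite eq_sym adj_sym.
Qed.

Lemma corona_irr (V1 V2 : finType) (G : sgraph V1) (H : sgraph V2) :
  irreflexive (corona_rel G H).
Proof. by move=> [x|[x a]] /=; rewrite ?(adj_irr G) ?(adj_irr H) ?andbF. Qed.

Definition corona (V1 V2 : finType) (G : sgraph V1) (H : sgraph V2) :
    sgraph (V1 + V1 * V2)%type :=
  SGraph (corona_sym G H) (corona_irr G H).

Definition psi (R : realType) (n k : nat) (l : R) : R :=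
  l * (l + k%:R + 2) / ((n%:R + 1) * l + k%:R + 2).

Definition psi_dom (R : realType) (n k : nat) : set R :=
  [set l | - ((k%:R + 2) / (n%:R + 1)) < l].

(* The inverse of the restriction of psi to psi_dom; it is 0 outside the image,
   but psi maps psi_dom onto R. *)
Definition psi_inv (R : realType) (n k : nat) : R -> R :=
  'pinv_(fun=> 0) (psi_dom n k) (psi n k).

(* Main.v *)
(* Write s x for the sum of f over a vertex x of G together with its copy of H,
   and f_x for the restriction of f to that copy.  If f is orthogonal to 1, then
     <f, D f> = <s, D_G s> - sum_x <f_x, (2 + A_H) f_x>,
   where s is again orthogonal to 1 and 2 + A_H is positive semidefinite because
   min ev(A_H) = -2.  If q := QEC(G) <= 0, the right-hand side is nonpositive, and
   an eigenvector of A_H for -2 placed in a single copy gives the value 0.  If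
   q > 0 and l := psi_*^{-1}(q), then 1/q = 1/l + n/(l + kappa + 2), so that
   Cauchy-Schwarz at each vertex, q (u + h)^2 <= l u^2 + (l + kappa + 2) h^2 / n,
   yields <f, D f> <= l <f, f>; spreading a maximiser of G over the copies in the
   proportion of the equality case attains it. *)
Require Import Defs.
From mathcomp Require Import all_boot all_order all_algebra.
From mathcomp Require Import all_classical all_reals all_analysis.
From mathcomp Require Import ring lra zify.

Set Implicit Arguments.
Unset Strict Implicit.
Unset Printing Implicit Defensive.

Import Order.TTheory GRing.Theory Num.Theory.
Import numFieldNormedType.Exports.

Local Open Scope classical_set_scope.
Local Open Scope ring_scope.

(** * Walks and graph distance *)

Section Walks.
Variables (V : finType) (G : sgraph V).

Lemma has_walkP (x y : V) (m : nat) :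
  reflect (exists p : seq V, [/\ size p = m, path G x p & last x p = y])
          (has_walk G x y m).
Proof.
apply: (iffP existsP) => [[p /andP[pP /eqP pl]]|[p [sp pP pl]]].
  by exists p; rewrite size_tuple.
have sp' : size p == m by apply/eqP.
by exists (Tuple sp'); rewrite /= pP pl eqxx.
Qed.

Lemma has_walk0 (x : V) : has_walk G x x 0.
Proof. by apply/has_walkP; exists [::]. Qed.

Lemma has_walk1 (x y : V) : G x y -> has_walk G x y 1.
Proof. by move=> xy; apply/has_walkP; exists [:: y]; rewrite /= xy. Qed.

Lemma has_walkD (x y z : V) (m k : nat) :
  has_walk G x y m -> has_walk G y z k -> has_walk G x z (m + k).
Proof.
move=> /has_walkP[p [<- pP pl]] /has_walkP[q [<- qP ql]].
by apply/has_walkP; exists (p ++ q); rewrite size_cat cat_path last_cat pl pP.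
Qed.

Lemma has_walk_connect (x y : V) (m : nat) : has_walk G x y m -> connect G x y.
Proof. by move=> /has_walkP[p [_ pP pl]]; apply/connectP; exists p. Qed.

(** Along a walk from [x], [phi] grows by at most one per step, so [phi y] bounds the length of
    every walk to [y] from below, and the assumed walk attains it. A candidate distance is thus
    certified without analysing shortest paths. *)
Lemma gdist_lipschitz_eq (x y : V) (phi : V -> nat) :
  phi x = 0%N -> (forall u v, G u v -> (phi v <= (phi u).+1)%N) ->
  has_walk G x y (phi y) -> gdist G x y = phi y.
Proof.
move=> phi0 phiL wy; have [wd dmin] := gdistP (has_walk_connect wy).
apply/eqP; rewrite eqn_leq dmin //=.
case/has_walkP: wd => p [<- pP <-].
rewrite -[size p]add0n -phi0; elim: p x {phi0 wy dmin} pP => [|z p IH] x /=.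
  by rewrite addn0.
by move=> /andP[/phiL xz /IH /leq_trans]; apply; rewrite addnS -addSn leq_add2r.
Qed.

Lemma gdist_refl (x : V) : gdist G x x = 0%N.
Proof.
apply/eqP; rewrite -leqn0.
by case: (gdistP (connect0 G x)) => _ -> //; exact: has_walk0.
Qed.

Lemma gdist_adj (x y z : V) : connect G x y -> G y z ->
  (gdist G x z <= (gdist G x y).+1)%N.
Proof.
move=> xy yz; have [wy _] := gdistP xy.
have wz := has_walkD wy (has_walk1 yz).
by have [_ ->] := gdistP (has_walk_connect wz); rewrite // -addn1.
Qed.

End Walks.

(** * Distances in the corona *)

Section CoronaDistance.
Variables (V1 V2 : finType) (G : sgraph V1) (H : sgraph V2).
Hypothesis G_conn : connected_graph G.

(** Copies meet the rest of the graph only at their base vertex, and two vertices of one copy are at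
    most 2 apart through it. *)
Definition corona_dist (u v : V1 + V1 * V2) : nat :=
  match u, v with
  | inl x, inl y => gdist G x y
  | inl x, inr (y, _) | inr (x, _), inl y => (gdist G x y).+1
  | inr (x, a), inr (y, b) =>
      if x == y then (if a == b then 0 else if H a b then 1 else 2)%N
      else (gdist G x y).+2
  end.

Lemma has_walk_inl (x y : V1) :
  has_walk (corona G H) (inl x) (inl y) (gdist G x y).
Proof.
have [/has_walkP[p [sp pP pl]] _] := gdistP (G_conn x y).
apply/has_walkP; exists (map inl p); rewrite size_map sp; split=> //.
  by rewrite path_map.
by rewrite last_map pl.
Qed.

Lemma has_walk_corona_dist (u v : V1 + V1 * V2) :
  has_walk (corona G H) u v (corona_dist u v).
Proof.
case: u v => [x|[x a]] [y|[y b]] /=.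
- exact: has_walk_inl.
- rewrite -addn1; apply: has_walkD (has_walk_inl x y) _.
  by apply: has_walk1; rewrite /= eqxx.
- rewrite -add1n; apply: has_walkD (has_walk_inl x y).
  by apply: has_walk1; rewrite /= eqxx.
have xa : has_walk (corona G H) (inr (x, a)) (inl x) 1.
  by apply: has_walk1; rewrite /= eqxx.
have yb : has_walk (corona G H) (inl y) (inr (y, b)) 1.
  by apply: has_walk1; rewrite /= eqxx.
case: eqP => [xy|_].
  rewrite xy in xa *; case: eqP => [->|_]; first exact: has_walk0.
  case: ifP => [ab|_]; first by apply: has_walk1; rewrite /= eqxx.
  exact: has_walkD xa yb.
(* The walk descends to the base [x], crosses [G] to [y], then climbs into the other copy. *)
rewrite -addn2 addnC -[2%N]/(1 + 1)%N -addnA; apply: has_walkD xa _.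
by rewrite addnC; apply: has_walkD (has_walk_inl x y) yb.
Qed.

Lemma corona_dist_adj (u v w : V1 + V1 * V2) : corona G H v w ->
  (corona_dist u w <= (corona_dist u v).+1)%N.
Proof.
have dG x y z : G y z -> (gdist G x z <= (gdist G x y).+1)%N.
  by apply: gdist_adj; exact: G_conn.
case: u v w => [x|[x a]] [y|[y b]] [z|[z c]] //=.
- exact: dG.
- by move=> /eqP ->.
- by move=> /eqP ->; lia.
- by move=> /andP[/eqP -> _]; lia.
- by move=> /dG; rewrite ltnS.
- by move=> /eqP ->; case: ifP => // _; case: ifP => // _; case: ifP.
- by move=> /eqP ->; case: ifP => [/eqP->|_]; rewrite ?gdist_refl //; lia.
move=> /andP[/eqP -> bc]; case: ifP => // _.
case: (eqVneq a c) => // ac; case: (eqVneq a b) => [->|ab]; first by rewrite bc.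
by case: (H a c); case: (H a b).
Qed.

Lemma gdist_corona (u v : V1 + V1 * V2) :
  gdist (corona G H) u v = corona_dist u v.
Proof.
apply: (@gdist_lipschitz_eq _ _ _ _ (corona_dist u)).
- by case: u => [x|[x a]] /=; rewrite ?gdist_refl ?eqxx.
- by move=> w z; exact: corona_dist_adj.
- exact: has_walk_corona_dist.
Qed.

End CoronaDistance.

(** * The branch of the inverse of [psi] *)

Section Psi.
Variables (R : realType) (n k : nat).
Hypothesis n_gt0 : (0 < n)%N.

Lemma psi_domE (l : R) : psi_dom n k l = (0 < (n%:R + 1) * l + k%:R + 2) :> Prop.
Proof.
have N0 : 0 < n%:R + 1 :> R by rewrite ltr_wpDl.
rewrite /psi_dom /= -mulNr ltr_pdivrMr //.
by apply/propext; split => h; lra.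
Qed.

(** Let d1, d2 > 0 be the two denominators. Up to the factor n + 1, the cross-multiplied difference
    is l1 - l2 times d1 d2 + n (k + 2)^2, which is positive. *)
Lemma psi_inj (l1 l2 : R) : psi_dom n k l1 -> psi_dom n k l2 ->
  psi n k l1 = psi n k l2 -> l1 = l2.
Proof.
rewrite !psi_domE /psi => d1 d2 /eqP.
rewrite eqr_div ?lt0r_neq0 // => /eqP e.
have n0 : 0 < n%:R :> R by rewrite ltr0n.
have k0 : 0 <= k%:R :> R by rewrite ler0n.
set N := n%:R in d1 d2 e n0; set K := k%:R in d1 d2 e k0.
have P : 0 < ((N + 1) * l1 + K + 2) * ((N + 1) * l2 + K + 2) + N * (K + 2) ^+ 2.
  by rewrite addr_gt0 ?mulr_gt0 ?exprn_gt0 //; lra.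
have /eqP : (l1 - l2) *
  (((N + 1) * l1 + K + 2) * ((N + 1) * l2 + K + 2) + N * (K + 2) ^+ 2) = 0.
  transitivity ((N + 1) * (l1 * (l1 + K + 2) * ((N + 1) * l2 + K + 2)
     - l2 * (l2 + K + 2) * ((N + 1) * l1 + K + 2))); first by ring.
  by rewrite e subrr mulr0.
by rewrite mulf_eq0 (gt_eqF P) orbF subr_eq0 => /eqP.
Qed.

(** The larger root of the quadratic equation obtained by clearing the denominator in
    [psi n k l = q]. *)
Definition psi_root (q : R) : R :=
  2^-1 * ((n%:R + 1) * q - (k%:R + 2) +
          Num.sqrt (((n%:R + 1) * q - (k%:R + 2)) ^+ 2 + 4 * (k%:R + 2) * q)).

(** The discriminant times (n + 1)^2 is a square plus 4 n (k + 2)^2 > 0, so its root strictly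
    exceeds the absolute value of what is squared. *)
Lemma psi_root_dom (q : R) : 0 < (n%:R + 1) * psi_root q + k%:R + 2.
Proof.
have n0 : 0 < n%:R :> R by rewrite ltr0n.
have k0 : 0 <= k%:R :> R by rewrite ler0n.
rewrite /psi_root; set N := n%:R in n0 *; set K := k%:R in k0 *.
set b := _ - (K + 2); set D := _ + _ * q.
have DE : (N + 1) ^+ 2 * D =
    ((N + 1) * b + 2 * (K + 2)) ^+ 2 + 4 * N * (K + 2) ^+ 2.
  by rewrite /D /b; ring.
have : `|(N + 1) * b + 2 * (K + 2)| < (N + 1) * Num.sqrt D.
  have {2}-> : N + 1 = Num.sqrt ((N + 1) ^+ 2).
    by rewrite sqrtr_sqr ger0_norm //; lra.
  rewrite -sqrtrM ?sqr_ge0 // DE -sqrtr_sqr ltr_sqrt.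
    by rewrite ltrDl !mulr_gt0 ?exprn_gt0 //; lra.
  by rewrite ltr_wpDl ?sqr_ge0 // !mulr_gt0 ?exprn_gt0 //; lra.
by rewrite ltr_norml => /andP[h _]; lra.
Qed.

Lemma psi_root_quad (q : R) :
  psi_root q * (psi_root q + k%:R + 2) =
  q * ((n%:R + 1) * psi_root q + k%:R + 2).
Proof.
have n0 : 0 < n%:R :> R by rewrite ltr0n.
have k0 : 0 <= k%:R :> R by rewrite ler0n.
rewrite /psi_root; set N := n%:R in n0 *; set K := k%:R in k0 *.
set b := _ - (K + 2); set D := _ + _ * q.
(* Since [q] may be negative, the sign of the discriminant is read off after completing the
   square. *)
have D0 : 0 <= D.
  have DE : (N + 1) ^+ 2 * D =
      ((N + 1) * b + 2 * (K + 2)) ^+ 2 + 4 * N * (K + 2) ^+ 2.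
    by rewrite /D /b; ring.
  have N2 : 0 < (N + 1) ^+ 2 by rewrite exprn_gt0 //; lra.
  rewrite -(pmulr_rge0 _ N2) DE addr_ge0 ?sqr_ge0 // mulr_ge0 ?sqr_ge0 //; lra.
have S := sqr_sqrtr D0; set r := Num.sqrt D in S *.
apply/eqP; rewrite -subr_eq0; apply/eqP.
transitivity (4^-1 * (r ^+ 2 - D)); last by rewrite S subrr mulr0.
by rewrite /D /b; field.
Qed.

(** The root lies in [psi_dom] and [psi] sends it to [q], so injectivity identifies it with the
    inverse value; the default 0 of [psi_inv] is never met. *)
Lemma psi_invE (q : R) : psi_inv n k q = psi_root q.
Proof.
have rd : psi_dom n k (psi_root q) by rewrite psi_domE psi_root_dom.
have e : psi n k (psi_root q) = q.
  by rewrite /psi psi_root_quad mulfK // gt_eqF // psi_root_dom.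
rewrite -{1}e /psi_inv pinvKV ?inE //.
by move=> x y; rewrite !inE => dx dy; exact: psi_inj.
Qed.

(** For [q] positive the discriminant exceeds b^2, so its square root outweighs a negative b. *)
Lemma psi_root_gt0 (q : R) : 0 < q -> 0 < psi_root q.
Proof.
move=> q0; have k0 : 0 <= k%:R :> R by rewrite ler0n.
rewrite /psi_root mulr_gt0 ?invr_gt0 //.
set b := _ - (_ + 2); set D := _ + _ * q.
have p : 0 < 4 * (k%:R + 2) * q by rewrite !mulr_gt0 //; lra.
have : `|b| < Num.sqrt D.
  have D0 : 0 < D by exact: ltr_wpDl (sqr_ge0 b) p.
  by rewrite -sqrtr_sqr ltr_sqrt // ltrDl.
by rewrite ltr_norml => /andP[h _]; lra.
Qed.

End Psi.

(** * Inner products and the least eigenvalue of a symmetric matrix *)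

Section Inner.
Variables (R : realType) (n : nat).
Implicit Types (u v w : 'cV[R]_n) (A : 'M[R]_n).

Lemma innerC u v : inner u v = inner v u.
Proof. by apply: eq_bigr => i _; rewrite mulrC. Qed.

Lemma innerDr u v w : inner u (v + w) = inner u v + inner u w.
Proof. by rewrite -big_split; apply: eq_bigr => i _; rewrite mxE mulrDr. Qed.

Lemma innerZr (c : R) u v : inner u (c *: v) = c * inner u v.
Proof. by rewrite mulr_sumr; apply: eq_bigr => i _; rewrite mxE mulrCA. Qed.

Lemma innerDl u v w : inner (u + v) w = inner u w + inner v w.
Proof. by rewrite ![inner _ w]innerC innerDr. Qed.

Lemma innerZl (c : R) u v : inner (c *: u) v = c * inner u v.
Proof. by rewrite innerC innerZr innerC. Qed.

Lemma inner_ge0 u : 0 <= inner u u.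
Proof. by apply: sumr_ge0 => i _; rewrite -expr2 sqr_ge0. Qed.

Lemma inner_eq0 u : (inner u u == 0) = (u == 0).
Proof.
apply/eqP/eqP => [u0|->]; last by rewrite /inner big1 // => i _; rewrite mxE mul0r.
apply/colP => i; rewrite mxE; apply/eqP; rewrite -sqrf_eq0 eq_le sqr_ge0 andbT.
rewrite -u0 /inner (bigD1 i) //= expr2 lerDl sumr_ge0 // => j _.
by rewrite -expr2 sqr_ge0.
Qed.

Lemma inner_mulmx u v A : inner u (A *m v) = inner (A^T *m u) v.
Proof.
transitivity (\sum_i \sum_j u i 0 * A i j * v j 0).
  apply: eq_bigr => i _; rewrite mxE mulr_sumr; apply: eq_bigr => j _.
  by rewrite mulrA.
rewrite exchange_big; apply: eq_bigr => j _; rewrite mxE mulr_suml.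
by apply: eq_bigr => i _; rewrite mxE [A i j * _]mulrC.
Qed.

Lemma inner_unit u : u != 0 -> exists2 c : R, 0 < c &
  inner (c *: u) (c *: u) = 1.
Proof.
move=> u0; have p : 0 < inner u u by rewrite lt_def inner_eq0 u0 inner_ge0.
exists (Num.sqrt (inner u u))^-1; first by rewrite invr_gt0 sqrtr_gt0.
rewrite innerZl innerZr mulrA -invfM -expr2 sqr_sqrtr ?inner_ge0 //.
by rewrite mulVf // gt_eqF.
Qed.

(** The quadratic form attains its minimum on the compact unit sphere, and homogeneity extends the
    bound to all vectors. Row vectors appear because the extreme value theorem is stated for
    them. *)
Lemma rayleigh_min A : (0 < n)%N -> exists2 v, inner v v = 1 &
  forall w, inner v (A *m v) * inner w w <= inner w (A *m w).
Proof.
move=> n0.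
pose S : set 'rV[R]_n := [set v : 'rV[R]_n | inner v^T v^T = 1].
have ctr i : continuous (fun v : 'rV[R]_n => v^T i 0).
  rewrite (_ : (fun r => _) = (fun v : 'rV[R]_n => v 0 i)).
    exact: coord_continuous.
  by apply/funext => v; rewrite mxE.
have cS : compact S.
  have Kco : compact [set v : 'rV[R]_n |
      forall i, `[(-1 : R), 1]%classic (v ord0 i)].
    apply: (@rV_compact _ _ (fun=> `[(-1 : R), 1]%classic)) => _.
    exact: segment_compact.
  apply: (subclosed_compact _ Kco).
    apply: (@preimage_closed _ _ (fun v : 'rV[R]_n => inner v^T v^T) [set 1]).
      by move=> v _; exact: continuous_inner.
    exact: closed_eq.
  move=> v v1 i /=; rewrite in_itv /= -ler_norml -(@ler_sqr R) ?nnegrE //.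
  rewrite expr1n -normrX ger0_norm ?sqr_ge0 // -v1 /inner (bigD1 i) //= !mxE.
  by rewrite expr2 lerDl sumr_ge0 // => j _; rewrite -expr2 sqr_ge0.
have S0 : S !=set0.
  pose e : 'cV[R]_n := const_mx 1.
  have e0 : e != 0.
    apply/eqP => /matrixP/(_ (Ordinal n0) 0); rewrite !mxE => /eqP.
    by rewrite oner_eq0.
  have [c _ ce] := inner_unit e0.
  by exists (c *: e)^T; rewrite /S /= trmxK.
pose F (v : 'rV[R]_n) := inner v^T (A *m v^T).
have cF : continuous F.
  apply: continuous_inner => // i.
  rewrite (_ : (fun r => _) = (fun v : 'rV[R]_n => \sum_j A i j * v^T j 0)).
    apply: continuous_sumr => j v.
    by apply: continuousM; [exact: cst_continuous | exact: ctr].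
  by apply/funext => v; rewrite mxE.
have [v vS vmin] := EVT_min_rV S0 cS (continuous_subspaceT cF).
exists v^T; first by move: vS; rewrite inE.
move=> w; case: (eqVneq w 0) => [->|w0].
  have z : inner (0 : 'cV[R]_n) 0 = 0 by apply/eqP; rewrite inner_eq0.
  by rewrite z mulr0 mulmx0 z.
have [c c0 cw] := inner_unit w0.
have := vmin (c *: w)^T; rewrite inE /S /= trmxK => /(_ cw).
rewrite /F trmxK -scalemxAr !innerZl !innerZr => h.
(* Multiplying by c^2 <w, w> = 1 exposes the common factor <w, w>. *)
have -> : inner w (A *m w) = c * (c * inner w (A *m w)) * inner w w.
  transitivity (inner w (A *m w) * (c * (c * inner w w))); last by ring.
  by rewrite -innerZr -innerZl cw mulr1.
by rewrite ler_wpM2r ?inner_ge0.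
Qed.

(* A minimiser v of the Rayleigh quotient, with minimum mu, is an eigenvector:
   z := A v - mu v would otherwise be a descent direction, as the form of
   A - mu at v + t z is 2 t |z|^2 + O(t^2). *)
Lemma symmetric_ge_eigenvalues A (c : R) : A^T = A ->
  lbound (ev A) c -> forall w, c * inner w w <= inner w (A *m w).
Proof.
move=> As lb w.
case: (posnP n) => [n0|n0].
  rewrite /inner !big1 ?mulr0 // => i _; exfalso; by case: i => i; rewrite n0.
have [v v1 vmin] := rayleigh_min A n0.
set mu := inner v (A *m v) in vmin.
suff lmu : eigenvalue A mu.
  by apply: le_trans (vmin w); rewrite ler_wpM2r ?inner_ge0 //; exact: lb.
have [z zE] : exists z, A *m v = z + mu *: v.
  by exists (A *m v - mu *: v); rewrite subrK.
have vz : inner v z = 0.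
  by apply: (addIr mu); rewrite add0r -[in LHS](mulr1 mu) -v1 -innerZr -innerDr -zE.
suff z0 : z = 0.
  (* Eigenvectors are row vectors in [eigenvalue]; symmetry of [A] allows the transposition. *)
  apply/eigenvalueP; exists v^T.
    by rewrite -[in LHS]As -trmx_mul zE z0 add0r linearZ.
  apply/eqP => v0; have /eqP vv : inner v v == 0.
    by rewrite inner_eq0 -[v]trmxK v0 trmx0.
  by move/eqP: v1; rewrite vv eq_sym oner_eq0.
apply/eqP; rewrite -inner_eq0; apply/eqP.
set a := inner z z; pose b := inner z (A *m z) - mu * a.
have key t : 0 <= 2 * t * a + t ^+ 2 * b.
  have := vmin (v + t *: z); rewrite -subr_ge0 mulmxDr -scalemxAr.
  rewrite !(innerDl, innerDr, innerZl, innerZr).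
  have -> : inner v (A *m z) = a.
    by rewrite inner_mulmx As zE innerDl innerZl vz mulr0 addr0.
  have -> : inner z (A *m v) = a.
    by rewrite zE innerDr innerZr [inner z v]innerC vz mulr0 addr0.
  rewrite [inner z v]innerC vz v1 -/mu -/a => h.
  by apply: le_trans h _; rewrite le_eqVlt /b; apply/orP; left; apply/eqP; ring.
have a0 : 0 <= a by exact: inner_ge0.
apply/eqP; rewrite eq_le a0 andbT leNgt; apply/negP => ap.
(* With d > 0 and d > b, the choice t = - a / d gives the value (a / d)^2 (b - 2 d) < 0, whatever
   the sign of b. *)
pose d := `|b| + 1; have d0 : 0 < d by rewrite ltr_wpDl.
have bd : b < d by rewrite /d (le_lt_trans (ler_norm b)) // ltrDl.
have := key (- (a / d)); rewrite leNgt => /negP; apply.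
have -> : 2 * - (a / d) * a + (- (a / d)) ^+ 2 * b
   = (a / d) ^+ 2 * (b - 2 * d) by field; rewrite gt_eqF.
by rewrite pmulr_rlt0 ?exprn_gt0 ?divr_gt0 //; lra.
Qed.

End Inner.

(** * Passage between functions on [V] and column vectors *)

Section Indexing.
Variables (R : realType) (V : finType).

Definition fun_col (f : V -> R) : 'cV[R]_#|V| := \col_i f (enum_val i).
Definition col_fun (u : 'cV[R]_#|V|) (x : V) : R := u (enum_rank x) 0.

Lemma col_funK (u : 'cV[R]_#|V|) : fun_col (col_fun u) = u.
Proof. by apply/colP => i; rewrite mxE /col_fun enum_valK. Qed.

Lemma sum_enum_val (F : V -> R) : \sum_(i < #|V|) F (enum_val i) = \sum_x F x.
Proof.
by rewrite [RHS](reindex_omap enum_val (fun x => Some (enum_rank x))) => [|x _];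
  rewrite /= ?enum_rankK //; apply: eq_bigl => i; rewrite enum_valK eqxx.
Qed.

Lemma inner_fun_col (f g : V -> R) :
  inner (fun_col f) (fun_col g) = \sum_x f x * g x.
Proof.
by rewrite -(sum_enum_val (fun x => f x * g x)); apply: eq_bigr => i _; rewrite !mxE.
Qed.

Lemma fun_col_const (c : R) : const_mx c = fun_col (fun=> c).
Proof. by apply/colP => i; rewrite !mxE. Qed.

Lemma mulmx_fun_col (M : V -> V -> R) (f : V -> R) :
  (\matrix_(i, j) M (enum_val i) (enum_val j)) *m fun_col f =
  fun_col (fun x => \sum_y M x y * f y).
Proof.
apply/colP => i; rewrite !mxE.
rewrite -(sum_enum_val (fun y => M (enum_val i) y * f y)).
by apply: eq_bigr => j _; rewrite !mxE.
Qed.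

End Indexing.

(** * QEC as the best constant in a homogeneous inequality *)

Section QECFunctional.
Variables (R : realType) (V : finType) (G : sgraph V).

Definition dform (f : V -> R) : R :=
  \sum_x f x * \sum_y (gdist G x y)%:R * f y.

Lemma inner_dist_mx (f : V -> R) :
  inner (fun_col f) (dist_mx R G *m fun_col f) = dform f.
Proof. by rewrite (mulmx_fun_col (fun x y => (gdist G x y)%:R)) inner_fun_col. Qed.

Lemma QEC_dom_fun_col (f : V -> R) :
  QEC_dom (fun_col f) <-> \sum_x f x * f x = 1 /\ \sum_x f x = 0.
Proof.
rewrite /QEC_dom /= fun_col_const !inner_fun_col.
by under [\sum_x 1 * _]eq_bigr do rewrite mul1r.
Qed.

Hypothesis V_gt1 : (1 < #|V|)%N.

Lemma QEC_attained : exists f : V -> R,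
  [/\ \sum_x f x * f x = 1, \sum_x f x = 0 & dform f = QEC R G].
Proof.
have [[u ud uq] _] := QEC_max R G V_gt1.
rewrite -(col_funK u) in ud uq; exists (col_fun u).
by rewrite -inner_dist_mx uq; case/QEC_dom_fun_col: ud.
Qed.

Lemma dform_scale (c : R) (f : V -> R) :
  dform (fun x => c * f x) = c ^+ 2 * dform f.
Proof.
rewrite /dform mulr_sumr; apply: eq_bigr => x _; rewrite expr2 !mulrA -!mulrA.
congr (_ * _); rewrite [RHS]mulrCA; congr (_ * _); rewrite mulr_sumr.
by apply: eq_bigr => y _; rewrite mulrCA.
Qed.

Lemma sumsq_gt0 (f : V -> R) (x : V) : f x != 0 -> 0 < \sum_x f x * f x.
Proof.
move=> fx; rewrite (bigD1 x) //= ltr_pwDl //.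
  by rewrite -expr2 lt_def sqrf_eq0 fx sqr_ge0.
by apply: sumr_ge0 => y _; rewrite -expr2 sqr_ge0.
Qed.

(** Scaling a nonzero [f] to unit norm reduces this to the upper bound property of QEC; both sides
    vanish for the zero function. *)
Lemma dform_le_QEC (f : V -> R) : \sum_x f x = 0 ->
  dform f <= QEC R G * \sum_x f x * f x.
Proof.
move=> f0; case: (pselect (forall x, f x = 0)) => [fz|/existsNP[x /eqP fx]].
  have -> : dform f = 0 by rewrite /dform big1 // => x _; rewrite fz mul0r.
  by rewrite big1 ?mulr0 // => x _; rewrite fz mul0r.
have S0 := sumsq_gt0 fx; set S := \sum_x _ in S0 *.
pose c := (Num.sqrt S)^-1.
have c2 : c ^+ 2 = S^-1 by rewrite /c exprVn sqr_sqrtr // ltW.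
have [_ ub] := QEC_max R G V_gt1.
have : dform (fun x => c * f x) <= QEC R G.
  apply: ub; exists (fun_col (fun x => c * f x)); last exact: inner_dist_mx.
  apply/QEC_dom_fun_col; split; last by rewrite -mulr_sumr f0 mulr0.
  under eq_bigr do rewrite mulrACA.
  by rewrite -mulr_sumr -expr2 c2 mulVf // gt_eqF.
by rewrite dform_scale c2 mulrC ler_pdivrMr.
Qed.

(** The criterion behind both cases of the theorem: a homogeneous bound together with a nonzero
    vector attaining it, so that extremal vectors need no normalisation. *)
Lemma QEC_eq (q : R) (f : V -> R) (x : V) :
  (forall g : V -> R, \sum_x g x = 0 -> dform g <= q * \sum_x g x * g x) ->
  \sum_x f x = 0 -> f x != 0 -> dform f = q * \sum_x f x * f x -> QEC R G = q.
Proof.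
move=> ub f0 fx fq; apply/le_anti/andP; split.
  by have [g [g1 g0 <-]] := QEC_attained; rewrite -[q]mulr1 -g1 ub.
have := dform_le_QEC f0.
by rewrite fq ler_pM2r // (sumsq_gt0 fx).
Qed.

End QECFunctional.

(** * The quadratic form of 2 + A_H for a regular graph *)

Section RegularGraph.
Variables (R : realType) (V : finType) (H : sgraph V) (k : nat).
Hypothesis H_reg : regular_graph H k.

Definition adj2_form (g : V -> R) : R :=
  \sum_a g a * \sum_b (2 *+ (a == b) + (H a b)%:R) * g b.

Lemma adj2_formE (g : V -> R) : adj2_form g =
  2 * (\sum_a g a * g a) + inner (fun_col g) (adj_mx R H *m fun_col g).
Proof.
rewrite (mulmx_fun_col (fun a b => (H a b)%:R)) inner_fun_col mulr_sumr -big_split /=.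
apply: eq_bigr => a _; rewrite mulrCA -mulrDr; congr (_ * _).
under [LHS]eq_bigr do rewrite mulrDl.
rewrite big_split /= (bigD1 a) //= eqxx big1 ?addr0 // => b ba.
by rewrite eq_sym (negbTE ba) mul0r.
Qed.

Lemma regular_sum (a : V) : \sum_b (H a b)%:R = k%:R :> R.
Proof.
rewrite -(H_reg a) -sum1_card natr_sum [RHS]big_mkcond /=.
by apply: eq_bigr => b _; rewrite inE; case: (H a b).
Qed.

Lemma adj_mx_sym : (adj_mx R H)^T = adj_mx R H.
Proof. by apply/matrixP => i j; rewrite !mxE adj_sym. Qed.

Hypothesis lb : lbound (ev (adj_mx R H)) (-2).

(** A symmetric matrix whose eigenvalues are all at least -2 becomes positive semidefinite after
    adding 2. *)
Lemma adj2_form_ge0 (g : V -> R) : 0 <= adj2_form g.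
Proof.
have := symmetric_ge_eigenvalues adj_mx_sym lb (fun_col g).
by rewrite adj2_formE inner_fun_col; lra.
Qed.

(** By regularity and symmetry all row and column sums of 2 + A_H equal k + 2, which evaluates the
    cross terms and the constant term. *)
Lemma adj2_form_shift (g : V -> R) (c : R) : adj2_form (fun a => g a - c) =
  adj2_form g - 2 * c * (k%:R + 2) * \sum_a g a + c ^+ 2 * #|V|%:R * (k%:R + 2).
Proof.
pose M a b : R := 2 *+ (a == b) + (H a b)%:R.
have Mr a : \sum_b M a b = k%:R + 2.
  rewrite big_split /= regular_sum addrC; congr (_ + _).
  rewrite (bigD1 a) //= eqxx big1 ?addr0 // => b ba.
  by rewrite eq_sym (negbTE ba).
have Mc b : \sum_a M a b = k%:R + 2.
  by rewrite -(Mr b); apply: eq_bigr => a _; rewrite /M eq_sym adj_sym.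
have E1 a : \sum_b M a b * (g b - c) = \sum_b M a b * g b - c * (k%:R + 2).
  by under eq_bigr do rewrite mulrBr; rewrite sumrB -mulr_suml Mr [_ * c]mulrC.
rewrite /adj2_form -/M; under eq_bigr do rewrite E1 mulrBl !mulrBr.
rewrite !sumrB -mulr_suml -mulr_sumr.
have -> : \sum_a \sum_b M a b * g b = (k%:R + 2) * \sum_a g a.
  rewrite exchange_big /= mulr_sumr; apply: eq_bigr => b _.
  by rewrite -mulr_suml Mc.
rewrite sumr_const -[in LHS]mulr_natr cardT -cardE; ring.
Qed.

Lemma adj2_form_const (c : R) :
  adj2_form (fun=> c) = c ^+ 2 * #|V|%:R * (k%:R + 2).
Proof.
have := adj2_form_shift (fun=> 0) (- c).
have -> : adj2_form (fun=> 0) = 0.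
  by rewrite /adj2_form big1 // => a _; rewrite mul0r.
by rewrite big1 // sqrrN mulr0 subr0 !add0r opprK => <-.
Qed.

(** Split [g] into its mean and its deviation from the mean. Constants are eigenvectors of l + 2 +
    A_H for l + k + 2, so the mean contributes the left-hand side; the deviation contributes a
    nonnegative amount. *)
Lemma sumsq_adj2_form_ge (l : R) (g : V -> R) : (0 < #|V|)%N -> 0 <= l ->
  (l + k%:R + 2) * (\sum_a g a) ^+ 2 / #|V|%:R <=
  l * (\sum_a g a * g a) + adj2_form g.
Proof.
move=> V0 l0; have n0 : 0 < #|V|%:R :> R by rewrite ltr0n.
set h := \sum_a g a; set n : R := #|V|%:R in n0 *.
have p1 := adj2_form_ge0 (fun a => g a - h / n).
have p2 : 0 <= \sum_a (g a - h / n) * (g a - h / n).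
  by apply: sumr_ge0 => a _; rewrite -expr2 sqr_ge0.
have e2 : \sum_a (g a - h / n) * (g a - h / n) = (\sum_a g a * g a) - h ^+ 2 / n.
  transitivity (\sum_a (g a * g a - 2 * (h / n) * g a + (h / n) ^+ 2)).
    by apply: eq_bigr => a _; ring.
  rewrite big_split sumrB -mulr_sumr -/h sumr_const -mulr_natr cardT -cardE -/n /=.
  by field; rewrite gt_eqF.
have e1 : adj2_form (fun a => g a - h / n) = adj2_form g - (k%:R + 2) * h ^+ 2 / n.
  by rewrite adj2_form_shift -/h -/n; field; rewrite gt_eqF.
have := mulr_ge0 l0 p2; rewrite e2; move: p1; rewrite e1 => p1 p3.
rewrite -subr_ge0; have := addr_ge0 p1 p3; congr (0 <= _); ring.
Qed.

(** Summing A_H g = -2 g over all vertices gives (k + 2) times the sum of [g] equal to 0, and k + 2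
    > 0 makes [g] orthogonal to 1. *)
Lemma adj_eigenvector : ev (adj_mx R H) (-2) ->
  exists (g : V -> R) (a : V), [/\ g a != 0, \sum_a g a = 0 & adj2_form g = 0].
Proof.
move=> /eigenvalueP[u uA u0]; pose g := col_fun u^T.
have gu : fun_col g = u^T by exact: col_funK.
have Ag : adj_mx R H *m fun_col g = fun_col (fun a => -2 * g a).
  rewrite gu -adj_mx_sym -trmx_mul uA; apply/colP => i.
  by rewrite !mxE /g /col_fun enum_valK mxE.
have eA a : \sum_b (H a b)%:R * g b = -2 * g a.
  move: Ag; rewrite (mulmx_fun_col (fun a b => (H a b)%:R)) => /colP/(_ (enum_rank a)).
  by rewrite !mxE enum_rankK.
have [a ga] : exists a, g a != 0.
  apply/existsP; rewrite -[X in is_true X]negbK; apply/negP => /existsPn g0.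
  move/eqP: u0; apply; apply/rowP => i; rewrite mxE.
  by have := g0 (enum_val i); rewrite negbK /g /col_fun enum_valK mxE => /eqP.
exists g, a; split=> //.
  have : \sum_a \sum_b (H a b)%:R * g b = k%:R * \sum_a g a.
    rewrite exchange_big mulr_sumr; apply: eq_bigr => b _; rewrite -mulr_suml.
    rewrite -(regular_sum b); congr (_ * _).
    by apply: eq_bigr => c _; rewrite adj_sym.
  under eq_bigr do rewrite eA; rewrite -mulr_sumr => e.
  have k0 : 0 <= k%:R :> R by rewrite ler0n.
  have /eqP : (k%:R + 2) * \sum_a g a = 0 by rewrite mulrDl -e; ring.
  rewrite mulf_eq0 => /orP[|/eqP //]; rewrite gt_eqF //; lra.
rewrite adj2_formE Ag inner_fun_col mulr_sumr -big_split /= big1 // => b _.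
by ring.
Qed.

End RegularGraph.

(** * The distance form of the corona *)

Section CoronaForm.
Variables (R : realType) (V1 V2 : finType) (G : sgraph V1) (H : sgraph V2).
Hypothesis G_conn : connected_graph G.

Definition corona_base (u : V1 + V1 * V2) : V1 :=
  match u with inl x => x | inr (x, _) => x end.

Definition corona_total (f : V1 + V1 * V2 -> R) (x : V1) : R :=
  f (inl x) + \sum_b f (inr (x, b)).

Lemma sum_corona (f : V1 + V1 * V2 -> R) :
  \sum_u f u = \sum_x corona_total f x.
Proof.
rewrite big_sumType big_split /=; congr (_ + _).
rewrite (pair_big predT predT (fun x b => f (inr (x, b)))) /=.
by apply: eq_bigr => -[].
Qed.

Lemma sum_corona_base (f : V1 + V1 * V2 -> R) (F : V1 -> R) :
  \sum_u f u * F (corona_base u) = \sum_x corona_total f x * F x.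
Proof.
rewrite sum_corona; apply: eq_bigr => x _.
by rewrite /corona_total /= -mulr_suml -mulrDl.
Qed.

(** Inside one copy, the excess of the length 2 through the base vertex over the true distance: 2 on
    the diagonal, 1 for neighbours, 0 otherwise. This is the matrix 2 + A_H, repeated in blocks. *)
Definition corona_corr (u v : V1 + V1 * V2) : R :=
  match u, v with
  | inr (x, a), inr (y, b) => (2 *+ (a == b) + (H a b)%:R) *+ (x == y)
  | _, _ => 0
  end.

Definition corona_level (u : V1 + V1 * V2) : R := if u is inr _ then 1 else 0.

(* The depth terms are invisible to vectors orthogonal to 1. *)
Lemma gdist_corona_split (u v : V1 + V1 * V2) :
  (gdist (corona G H) u v)%:R =
  (gdist G (corona_base u) (corona_base v))%:R +
  corona_level u + corona_level v - corona_corr u v.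
Proof.
rewrite gdist_corona //; case: u v => [x|[x a]] [y|[y b]] /=.
- by rewrite subr0 !addr0.
- by rewrite subr0 addr0 -natr1.
- by rewrite subr0 addr0 -natr1.
case: eqP => [->|_]; last by rewrite subr0 -!natr1.
rewrite gdist_refl; case: eqP => [->|_].
  by rewrite (adj_irr H) /=; ring.
by case: (H a b) => /=; ring.
Qed.

(** In the splitting of the distance, each level term depends on one argument only and dies on
    summing over the other. The base distance sees [f] only through [corona_total], and the
    correction is block diagonal. *)
Lemma dform_corona (f : V1 + V1 * V2 -> R) : \sum_u f u = 0 ->
  dform (corona G H) f =
  dform G (corona_total f) - \sum_x adj2_form H (fun a => f (inr (x, a))).
Proof.
move=> f0; pose s := corona_total f.
pose T : R := \sum_v corona_level v * f v.
have inE u : \sum_v (gdist (corona G H) u v)%:R * f v =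
    (\sum_y (gdist G (corona_base u) y)%:R * s y) + T
    - \sum_v corona_corr u v * f v.
  under eq_bigr do rewrite gdist_corona_split mulrBl !mulrDl.
  rewrite sumrB !big_split /= -[\sum_i corona_level u * _]mulr_sumr f0 mulr0 addr0.
  congr (_ + _ - _).
  under eq_bigr do rewrite mulrC.
  rewrite (sum_corona_base f (fun y => (gdist G (corona_base u) y)%:R)).
  by apply: eq_bigr => y _; rewrite mulrC.
rewrite /dform; under eq_bigr do rewrite inE mulrBr mulrDr.
rewrite sumrB big_split /= -[\sum_i f i * T]mulr_suml f0 mul0r addr0.
congr (_ - _).
  exact: (sum_corona_base f (fun x => \sum_y (gdist G x y)%:R * s y)).
rewrite sum_corona; apply: eq_bigr => x _; rewrite /corona_total /=.
rewrite [X in f (inl x) * X]big1 ?mulr0 ?add0r => [|v _]; last by rewrite mul0r.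
apply: eq_bigr => a _; congr (_ * _).
rewrite sum_corona /corona_total /= (bigD1 x) //= [X in _ + X]big1 => [|y yx].
  by rewrite mul0r add0r addr0 eqxx.
by rewrite mul0r add0r big1 // => b _; rewrite [x == y]eq_sym (negbTE yx) mul0r.
Qed.

End CoronaForm.

Theorem theorem4p17 (R : realType) (V1 V2 : finType)
    (G : sgraph V1) (H : sgraph V2) (n kappa : nat)
    (V1_ge2 : (2 <= #|V1|)%N) (G_conn : connected_graph G)
    (n_def : n = #|V2|) (n_ge1 : (1 <= n)%N)
    (H_reg : regular_graph H kappa)
    (min_ev : ev (adj_mx R H) (-2) /\ lbound (ev (adj_mx R H)) (-2)) :
  QEC R (corona G H) =
    (if 0 < QEC R G then psi_inv n kappa (QEC R G) else 0) /\
  psi_inv n kappa (QEC R G) =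
    2^-1 * ((n%:R + 1) * QEC R G - (kappa%:R + 2) +
            Num.sqrt (((n%:R + 1) * QEC R G - (kappa%:R + 2)) ^+ 2 +
                      4 * (kappa%:R + 2) * QEC R G)).
Proof.
have [ev2 lb2] := min_ev.
have piE := psi_invE kappa n_ge1 (QEC R G).
split; last exact: piE.
have C_gt1 : (1 < #|{: V1 + V1 * V2}|)%N.
  by rewrite card_sum (leq_trans V1_ge2) // leq_addr.
have A0 := adj2_form_ge0 lb2.
case: ltrP => q0.
- rewrite piE; set q := QEC R G in q0 *.
  set l := psi_root n kappa q.
  have l0 : 0 < l by exact: psi_root_gt0.
  have := psi_root_quad kappa n_ge1 q; rewrite -/l.
  set k : R := kappa%:R; set N : R := n%:R => lq.
  have k0 : 0 <= k by rewrite ler0n.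
  have N0 : 0 < N by rewrite ltr0n.
  have sumV2 (c : R) : \sum_(b : V2) c = c * N.
    by rewrite sumr_const -mulr_natr cardT -cardE -n_def.
  have lk0 : 0 < l + k + 2 by lra.
  have qd : 0 < (N + 1) * l + k + 2.
    by have := mulr_gt0 N0 l0; lra.
  (* Eliminating q in favour of l turns the remaining identities into rational ones, within reach of
     [field]. *)
  have qE : q = l * (l + k + 2) / ((N + 1) * l + k + 2).
    by rewrite lq mulfK // gt_eqF.
  have [s [s1 s0 sq]] := QEC_attained R G V1_ge2.
  have [x sx] : exists x, s x != 0.
    apply/existsP; rewrite -[X in is_true X]negbK; apply/negP => /existsPn h.
    move/eqP: s1; rewrite big1 => [|y _]; first by rewrite eq_sym oner_eq0.
    by have := h y; rewrite negbK => /eqP ->; rewrite mul0r.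
  (* The equality case: N l u = (l + k + 2) h for the base value u and the copy sum h, scaled so
     that the total at each vertex is again [s]. *)
  pose f (u : V1 + V1 * V2) : R := match u with
    inl y => q / l * s y | inr (y, _) => q / (l + k + 2) * s y end.
  have ft : corona_total f = s.
    apply/funext => y; rewrite /corona_total /= sumV2 qE; field.
    by rewrite !gt_eqF.
  apply: (@QEC_eq _ _ _ C_gt1 _ f (inl x)).
  + move=> g g0; rewrite dform_corona //.
    have ts0 : \sum_y corona_total g y = 0 by rewrite -sum_corona.
    have := dform_le_QEC G V1_ge2 ts0; rewrite -/q => h.
    (* Once the form of [G] is bounded by q times the squared norm of the totals, the claim
       separates into one inequality per vertex of [G]. *)
    rewrite lerBlDr (le_trans h) // sum_corona mulr_sumr.
    rewrite mulr_sumr -big_split; apply: ler_sum => y _ /=.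
    rewrite /corona_total; set c := g (inl y); set hh := \sum_b g _.
    have V20 : (0 < #|V2|)%N by rewrite -n_def.
    have := sumsq_adj2_form_ge H_reg lb2
      (fun a => g (inr (y, a))) V20 (ltW l0).
    rewrite -n_def -/N -/k -/hh => h2.
    rewrite [l * (_ + _)]mulrDr -addrA; apply: le_trans (lerD (lexx _) h2).
    (* Cauchy-Schwarz, since 1/q = 1/l + N/(l+k+2) *)
    rewrite -subr_ge0.
    have -> : l * (c * c) + (l + k + 2) * hh ^+ 2 / N - q * ((c + hh) * (c + hh))
      = (N * l * c - (l + k + 2) * hh) ^+ 2 / (N * ((N + 1) * l + k + 2)).
      by rewrite qE; field; rewrite !gt_eqF.
    by rewrite mulr_ge0 ?sqr_ge0 // invr_ge0 mulr_ge0 // ltW.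
  + by rewrite sum_corona ft.
  + by rewrite /= !mulf_neq0 ?invr_eq0 // gt_eqF.
  have f0 : \sum_u f u = 0 by rewrite sum_corona ft.
  (* Writing q as q times the squared norm of [s] lets equality be checked vertex by vertex. *)
  rewrite dform_corona // ft sq -/q -[q in LHS]mulr1 -s1 sum_corona.
  rewrite !mulr_sumr -sumrB; apply: eq_bigr => y _.
  rewrite /corona_total /= (adj2_form_const H_reg).
  by rewrite sumV2 -n_def -/N -/k qE; field; rewrite !gt_eqF.
have [g [a [ga gs g2]]] := adj_eigenvector H_reg ev2.
have [x0 _] : exists x0 : V1, x0 \in predT by apply/card_gt0P; exact: ltnW.
(* The eigenvector for -2 sits in the copy at [x0]; as its entries sum to 0, all totals vanish and
   so do both terms of the form. *)
pose f (u : V1 + V1 * V2) : R :=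
  if u is inr (x, b) then g b *+ (x == x0) else 0.
have ft x : corona_total f x = 0.
  by rewrite /corona_total /= add0r sumrMnl gs mul0rn.
have f0 : \sum_u f u = 0 by rewrite sum_corona big1.
apply: (@QEC_eq _ _ _ C_gt1 _ f (inr (x0, a))) => //.
- move=> h h0; rewrite dform_corona // mul0r.
  have ts0 : \sum_y corona_total h y = 0 by rewrite -sum_corona.
  have hq := dform_le_QEC G V1_ge2 ts0.
  (* Here QEC(G) <= 0 makes the form of the totals nonpositive, while the subtracted forms are
     nonnegative. *)
  rewrite subr_le0 (le_trans hq) // (@le_trans _ _ 0) //.
    by rewrite mulr_le0_ge0 // sumr_ge0 // => y _; rewrite -expr2 sqr_ge0.
  by rewrite sumr_ge0.
- by rewrite /= eqxx mulr1n.
rewrite dform_corona // mul0r.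
have -> : dform G (corona_total f) = 0.
  by rewrite /dform big1 // => x _; rewrite ft mul0r.
rewrite big1 ?subr0 // => x _.
case: (eqVneq x x0) => [->|/negbTE xx] /=.
  by rewrite -[RHS]g2; congr (adj2_form H); apply/funext => b; rewrite eqxx.
by rewrite /adj2_form big1 // => b _; rewrite /= xx mul0r.
Qed.
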